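(* Let $G$ be a set, $L$ a normal modal logic with the finite model property, $\kappa$ a sufficiently large regular cardinal for $G$, $T\subseteq\mathrm{Fm}_\kappa(G)$, and $\Gamma,\Delta\subseteq\mathrm{Fm}_\kappa(G)$. If $(G,\kappa,L,T)\vDash\Gamma\Rightarrow\Delta$, then $(G,\kappa,L,T)\vdash\Gamma\Rightarrow\Delta$.
   Context: A regular cardinal $\kappa$ is sufficiently large for $G$ if $\kappa>2^{\kappa_0}$ for some $\kappa_0\ge2^{2^{|\mathrm{Fm}_\omega(G)|}}$, where $\mathrm{Fm}_\omega(G)$ is the set of finitary modal formulas over $G$. $\mathrm{Fm}_\kappa(G)$ is the least set containing $G$ closed under $\neg$, $\Box$, and $\bigwedge S,\bigvee S$ for sets $S$ of size $<\kappa$. The calculus $(G,\kappa,L,T)$ has rules: (Ax) $\varphi\Rightarrow\varphi$; (W) from $\Gamma\Rightarrow\Delta$ infer $\Gamma,\Gamma'\Rightarrow\Delta,\Delta'$; (Cut) from $\Gamma\Rightarrow\Delta,\varphi$ for every $\varphi\in S$ and $S,\Gamma'\Rightarrow\Delta'$ infer $\Gamma,\Gamma'\Rightarrow\Delta,\Delta'$; (L$\neg$) from $\Gamma\Rightarrow\Delta,S$ infer $\neg S,\Gamma\Rightarrow\Delta$; (R$\neg$) from $S,\Gamma\Rightarrow\Delta$ infer $\Gamma\Rightarrow\Delta,\neg S$; for a family $\mathscr S$ of sets each of size $<\kappa$: (L$\bigwedge$) from $\bigcup\mathscr S,\Gamma\Rightarrow\Delta$ infer $\{\bigwedge S:S\in\mathscr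 S\},\Gamma\Rightarrow\Delta$; (R$\bigwedge$) from $\Gamma\Rightarrow\Delta,\{c(S):S\in\mathscr S\}$ for every choice function $c$ infer $\Gamma\Rightarrow\Delta,\{\bigwedge S:S\in\mathscr S\}$; (L$\bigvee$) from $\{c(S)\},\Gamma\Rightarrow\Delta$ for every choice function $c$ infer $\{\bigvee S\},\Gamma\Rightarrow\Delta$; (R$\bigvee$) from $\Gamma\Rightarrow\Delta,\bigcup\mathscr S$ infer $\Gamma\Rightarrow\Delta,\{\bigvee S\}$; (Nec) from $S\Rightarrow\varphi$ infer $\Box S\Rightarrow\Box\varphi$; (lf) for sets $S_n$ of size $<\kappa$: from $\{\Box^n\bigvee(I\cap S_n):n\in\omega\},\Gamma\Rightarrow\Delta$ for every finite $I\subseteq\bigcup_nS_n$ infer $\{\Box^n\bigvee S_n:n\in\omega\},\Gamma\Rightarrow\Delta$; (T,L) from $S,\Gamma\Rightarrow\Delta$ infer $\Gamma\Rightarrow\Delta$ for $S\subseteq T\cup L_{(G,\kappa)}$ (substitution instances of theorems of $L$). Proofs are well-founded trees. A profinite $L$-algebra is an $L$-algebra isomorphic to the powerset modal algebra of a locally finite Kripke frame. $(G,\kappa,L,T)\vDash\Gamma\Rightarrow\Delta$ means: for every profinite $L$-algebra $M$ and every map $v:G\to M$ (extended to formulas using the complete operations of $M$) with $v(\varphi)=\top$ for all $\varphi\in T$, $\bigwedge v(\Gamma)\le\bigvee v(\Delta)$. *)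

(* Defs.v *)
(* Infinitary modal logic: Fm_kappa(G), the calculus (G,kappa,L,T),
   and semantics in profinite L-algebras (powerset algebras of locally finite frames). *)
From Stdlib Require Import List Relations.
Import ListNotations.
Set Implicit Arguments.

Definition injective {A B : Type} (f : A -> B) : Prop :=
  forall x y, f x = f y -> x = y.

(* |A| < |K|  (in ZFC: no injection K -> A) *)
Definition small (K : Type) (A : Type) : Prop :=
  ~ exists h : K -> A, injective h.

Definition regular (K : Type) : Prop :=
  (exists f : nat -> K, injective f) /\
  forall (P : K -> Prop) (Q : K -> K -> Prop),
    small K {k : K | P k} ->
    (forall k, P k -> small K {y : K | Q k y}) ->
    small K {y : K | exists k, P k /\ Q k y}.

Inductive FmFin (G : Type) : Type :=
| ffVar : G -> FmFin G
| ffNeg : FmFin G -> FmFin G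
| ffBox : FmFin G -> FmFin G
| ffAnd : list (FmFin G) -> FmFin G
| ffOr  : list (FmFin G) -> FmFin G.

Definition sufficiently_large (G K : Type) : Prop :=
  regular K /\
  exists K0 : Type,
    (exists f : ((FmFin G -> Prop) -> Prop) -> K0, injective f) /\
    (exists g : (K0 -> Prop) -> K, injective g) /\
    ~ (exists h : K -> (K0 -> Prop), injective h).

Inductive BFm : Type :=
| bVar : nat -> BFm
| bNeg : BFm -> BFm
| bAnd : BFm -> BFm -> BFm
| bOr  : BFm -> BFm -> BFm
| bBox : BFm -> BFm.

Definition bImp (a b : BFm) : BFm := bOr (bNeg a) b.

Fixpoint bsubst (s : nat -> BFm) (a : BFm) : BFm :=
  match a with
  | bVar n => s n
  | bNeg a => bNeg (bsubst s a)
  | bAnd a b => bAnd (bsubst s a) (bsubst s b)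
  | bOr a b => bOr (bsubst s a) (bsubst s b)
  | bBox a => bBox (bsubst s a)
  end.

Fixpoint tv (val : BFm -> bool) (a : BFm) : bool :=
  match a with
  | bVar n => val (bVar n)
  | bNeg a => negb (tv val a)
  | bAnd a b => andb (tv val a) (tv val b)
  | bOr a b => orb (tv val a) (tv val b)
  | bBox a => val (bBox a)
  end.

Definition tautology (a : BFm) : Prop := forall val, tv val a = true.

Definition normal_logic (L : BFm -> Prop) : Prop :=
  (forall a, tautology a -> L a) /\
  L (bImp (bBox (bImp (bVar 0) (bVar 1))) (bImp (bBox (bVar 0)) (bBox (bVar 1)))) /\
  (forall a b, L (bImp a b) -> L a -> L b) /\
  (forall a, L a -> L (bBox a)) /\
  (forall a s, L a -> L (bsubst s a)).

Fixpoint bsem {W : Type} (R : W -> W -> Prop) (V : nat -> W -> Prop) (a : BFm) : W -> Prop :=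
  match a with
  | bVar n => V n
  | bNeg a => fun x => ~ bsem R V a x
  | bAnd a b => fun x => bsem R V a x /\ bsem R V b x
  | bOr a b => fun x => bsem R V a x \/ bsem R V b x
  | bBox a => fun x => forall y, R x y -> bsem R V a y
  end.

(* the frame validates L, i.e. its powerset algebra is an L-algebra *)
Definition frame_valid {W : Type} (R : W -> W -> Prop) (L : BFm -> Prop) : Prop :=
  forall V a, L a -> forall x, bsem R V a x.

Definition finite_type (W : Type) : Prop := exists l : list W, forall w, In w l.

Definition fmp (L : BFm -> Prop) : Prop :=
  forall a, ~ L a ->
    exists (W : Type) (R : W -> W -> Prop),
      finite_type W /\ frame_valid R L /\ exists V x, ~ bsem R V a x.

Definition loc_finite {W : Type} (R : W -> W -> Prop) : Prop :=
  forall x, exists l : list W, forall y, clos_refl_trans W R x y -> In y l.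

(* Conj I f / Disj I f is the conjunction / disjunction of the set {f i | i : I}. *)
Inductive Fm (G : Type) : Type :=
| Var : G -> Fm G
| Neg : Fm G -> Fm G
| Box : Fm G -> Fm G
| Conj : forall I : Type, (I -> Fm G) -> Fm G
| Disj : forall I : Type, (I -> Fm G) -> Fm G.
Arguments Var {G}. Arguments Neg {G}. Arguments Box {G}.
Arguments Conj {G}. Arguments Disj {G}.

Inductive wf (G K : Type) : Fm G -> Prop :=
| wf_var g : wf K (Var g)
| wf_neg a : wf K a -> wf K (Neg a)
| wf_box a : wf K a -> wf K (Box a)
| wf_conj (I : Type) (f : I -> Fm G) : small K I -> (forall i, wf K (f i)) -> wf K (Conj I f)
| wf_disj (I : Type) (f : I -> Fm G) : small K I -> (forall i, wf K (f i)) -> wf K (Disj I f).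

Fixpoint boxn {G : Type} (n : nat) (a : Fm G) : Fm G :=
  match n with 0 => a | S n => Box (boxn n a) end.

Fixpoint tr {G : Type} (s : nat -> Fm G) (a : BFm) : Fm G :=
  match a with
  | bVar n => s n
  | bNeg a => Neg (tr s a)
  | bAnd a b => Conj bool (fun x : bool => if x then tr s a else tr s b)
  | bOr a b => Disj bool (fun x : bool => if x then tr s a else tr s b)
  | bBox a => Box (tr s a)
  end.

Definition Linst (G K : Type) (L : BFm -> Prop) : Fm G -> Prop :=
  fun p => exists a s, L a /\ (forall n, wf K (s n)) /\ p = tr s a.

Fixpoint eval {G W : Type} (R : W -> W -> Prop) (v : G -> W -> Prop) (p : Fm G) : W -> Prop :=
  match p with
  | Var g => v g
  | Neg a => fun x => ~ eval R v a x
  | Box a => fun x => forall y, R x y -> eval R v a y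
  | Conj _ f => fun x => forall i, eval R v (f i) x
  | Disj _ f => fun x => exists i, eval R v (f i) x
  end.

Definition valid (G : Type) (L : BFm -> Prop) (T Gam Del : Fm G -> Prop) : Prop :=
  forall (W : Type) (R : W -> W -> Prop),
    loc_finite R -> frame_valid R L ->
    forall v : G -> W -> Prop,
      (forall p, T p -> forall x, eval R v p x) ->
      forall x, (forall p, Gam p -> eval R v p x) -> exists q, Del q /\ eval R v q x.

Definition sing {G : Type} (p : Fm G) : Fm G -> Prop := fun q => q = p.
Definition un {G : Type} (X Y : Fm G -> Prop) : Fm G -> Prop := fun q => X q \/ Y q.
Definition negs {G : Type} (X : Fm G -> Prop) : Fm G -> Prop :=
  fun q => exists p, X p /\ q = Neg p.
Definition boxes {G : Type} (X : Fm G -> Prop) : Fm G -> Prop :=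
  fun q => exists p, X p /\ q = Box p.
Definition image {G : Type} (c : Fm G -> Fm G) (X : Fm G -> Prop) : Fm G -> Prop :=
  fun q => exists p, X p /\ q = c p.

Definition all_conj {G : Type} (A : Fm G -> Prop) : Prop :=
  forall p, A p -> exists I f, p = Conj I f.
Definition all_disj {G : Type} (A : Fm G -> Prop) : Prop :=
  forall p, A p -> exists I f, p = Disj I f.
Definition conjuncts {G : Type} (A : Fm G -> Prop) : Fm G -> Prop :=
  fun q => exists I (f : I -> Fm G) i, A (Conj I f) /\ q = f i.
Definition disjuncts {G : Type} (A : Fm G -> Prop) : Fm G -> Prop :=
  fun q => exists I (f : I -> Fm G) i, A (Disj I f) /\ q = f i.
Definition choice_conj {G : Type} (A : Fm G -> Prop) (c : Fm G -> Fm G) : Prop :=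
  forall I f, A (Conj I f) -> exists i, c (Conj I f) = f i.
Definition choice_disj {G : Type} (A : Fm G -> Prop) (c : Fm G -> Fm G) : Prop :=
  forall I f, A (Disj I f) -> exists i, c (Disj I f) = f i.

(* {box^n \/ S_n : n} and {box^n \/ (I cap S_n) : n} for finite I (a list) *)
Definition lf_set {G : Type} (Is : nat -> Type) (fs : forall n, Is n -> Fm G) : Fm G -> Prop :=
  fun q => exists n, q = boxn n (Disj (Is n) (fs n)).
Definition lf_fin {G : Type} (Is : nat -> Type) (fs : forall n, Is n -> Fm G)
    (l : list (Fm G)) : Fm G -> Prop :=
  fun q => exists n, q = boxn n (Disj {i : Is n | In (fs n i) l}
                                      (fun i => fs n (proj1_sig i))).

(* ---------- the calculus (G,kappa,L,T); every sequent consists of Fm_kappa(G)-formulas ---------- *)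
Section Calc.
Variables (G K : Type) (L : BFm -> Prop) (T : Fm G -> Prop).

Definition WS (X : Fm G -> Prop) : Prop := forall p, X p -> wf K p.

Inductive Prov : (Fm G -> Prop) -> (Fm G -> Prop) -> Prop :=
| r_ax p : wf K p -> Prov (sing p) (sing p)
| r_w Gam Del Gam' Del' : WS (un Gam Gam') -> WS (un Del Del') ->
    Prov Gam Del -> Prov (un Gam Gam') (un Del Del')
| r_cut Gam Del Gam' Del' (S : Fm G -> Prop) :
    WS (un Gam Gam') -> WS (un Del Del') ->
    (forall p, S p -> Prov Gam (un Del (sing p))) ->
    Prov (un S Gam') Del' -> Prov (un Gam Gam') (un Del Del')
| r_negL Gam Del S : WS (un (negs S) Gam) -> WS Del ->
    Prov Gam (un Del S) -> Prov (un (negs S) Gam) Del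
| r_negR Gam Del S : WS Gam -> WS (un Del (negs S)) ->
    Prov (un S Gam) Del -> Prov Gam (un Del (negs S))
| r_andL Gam Del A : all_conj A -> WS (un A Gam) -> WS Del ->
    Prov (un (conjuncts A) Gam) Del -> Prov (un A Gam) Del
| r_andR Gam Del A : all_conj A -> WS Gam -> WS (un Del A) ->
    (forall c, choice_conj A c -> Prov Gam (un Del (image c A))) ->
    Prov Gam (un Del A)
| r_orL Gam Del A : all_disj A -> WS (un A Gam) -> WS Del ->
    (forall c, choice_disj A c -> Prov (un (image c A) Gam) Del) ->
    Prov (un A Gam) Del
| r_orR Gam Del A : all_disj A -> WS Gam -> WS (un Del A) ->
    Prov Gam (un Del (disjuncts A)) -> Prov Gam (un Del A)
| r_nec S p : WS (boxes S) -> WS (sing (Box p)) ->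
    Prov S (sing p) -> Prov (boxes S) (sing (Box p))
| r_lf Gam Del (Is : nat -> Type) (fs : forall n, Is n -> Fm G) :
    WS (un (lf_set Is fs) Gam) -> WS Del ->
    (forall l : list (Fm G), (forall q, In q l -> exists n i, fs n i = q) ->
       Prov (un (lf_fin Is fs l) Gam) Del) ->
    Prov (un (lf_set Is fs) Gam) Del
| r_TL Gam Del S : WS Gam -> WS Del ->
    (forall p, S p -> T p \/ Linst K L p) ->
    Prov (un S Gam) Del -> Prov Gam Del.
End Calc.

(* Main.v *)
From Stdlib Require Import List Classical ClassicalEpsilon
  FunctionalExtensionality PropExtensionality.
Require Import Defs.
Import ListNotations.
Set Implicit Arguments.

(** Canonical model argument.  Since (L\/) accepts arbitrary sets of disjunctions,
    applying it to all [p \/ ~p] and cutting shows that an underivable sequent extends to an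
    underivable partition [(X, complement of X)] of the formulas; these sets [X] are the points
    of a canonical model, with the usual truth lemma.  There are fewer than kappa complete
    finitary theories, so the disjunction of their characteristic formulas is a formula true at
    every point.  The rule (lf) applied to it shows that only finitely many finitary theories are
    realised at the points reachable from a given [X].  Finitely many theories
    are separated by finitary formulas, hence "same finitary theory" is a bisimulation on the
    reachable points, and its quotient is a finite model.  Every subset of the quotient is
    definable, so the theorems of [L], whose instances all hold, are valid in its frame. *)

(** * Extensionality and cardinality *)

Lemma set_ext (A : Type) (X Y : A -> Prop) : (forall a, X a <-> Y a) -> X = Y.
Proof.
intro H; apply functional_extensionality; intro a; apply propositional_extensionality, H.
Qed.

Lemma small_inj (K A B : Type) (f : A -> B) : injective f -> small K B -> small K A.
Proof.
intros Hf HB [h Hh]; apply HB; exists (fun k => f (h k)); intros x y E; apply Hh, Hf, E.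
Qed.

Lemma small_sig (K A : Type) (P : A -> Prop) : small K A -> small K {a | P a}.
Proof.
apply small_inj with (f := @proj1_sig A P).
intros [x Hx] [y Hy]; simpl; intros <-; f_equal; apply proof_irrelevance.
Qed.

Lemma singleton_inj (A : Type) : injective (fun a b : A => b = a).
Proof.
intros x y E; change ((fun b => b = y) x); rewrite <- E; reflexivity.
Qed.

(** Singletons embed [FmFin G -> Prop] in its powerset, [f] leads from there into [K0], and
    singletons again into the powerset of [K0], which is smaller than [K]. *)
Lemma sufficiently_large_small (G K : Type) :
  sufficiently_large G K -> small K (FmFin G -> Prop).
Proof.
intros [_ [K0 [[f Hf] [_ HK]]]].
apply small_inj with (2 := HK) (f := fun X k => k = f (fun Y => Y = X)).
intros x y E; apply (@singleton_inj K0) in E.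
apply Hf in E; exact (@singleton_inj _ _ _ E).
Qed.

Lemma finite_preimage (W B : Type) (f : W -> B) (l : list B) :
  injective f -> exists lw, forall w, In (f w) l -> In w lw.
Proof.
intro Hf; induction l as [|b l [lw IH]]; [exists []; intros w []|].
destruct (classic (exists w, f w = b)) as [[w0 <-]|N].
- exists (w0 :: lw); intros w [E|Hw]; [left; apply Hf, E|right; apply IH, Hw].
- exists lw; intros w [E|Hw]; [destruct N; exists w; congruence|apply IH, Hw].
Qed.

(* Binary conjunctions and [ffAnd []] (truth) are all that is needed; the remaining shapes are
   sent to junk. *)
Fixpoint embed (G : Type) (a : FmFin G) : Fm G :=
  match a with
  | ffVar g => Var g
  | ffNeg a => Neg (embed a)
  | ffBox a => Box (embed a)
  | ffAnd (a :: b :: _) => Conj bool (fun x : bool => if x then embed a else embed b)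
  | _ => Conj False (fun e => match e with end)
  end.

(** * Well-formed formulas and structural rules *)

Section Canonical.
Variables (G K : Type) (L : BFm -> Prop) (T : Fm G -> Prop).
Hypothesis WT : WS K T.
Hypothesis HK : small K (FmFin G -> Prop).

Let prov := Prov K L T.

Definition none : Fm G -> Prop := fun _ => False.

(** Inversion of [wf] stated as a [match], which avoids the equalities of dependent pairs that
    inverting [wf K (Conj I f)] would produce. *)
Lemma wf_sub (p : Fm G) : wf K p ->
  match p with
  | Var _ => True
  | Neg a => wf K a
  | Box a => wf K a
  | Conj _ f => forall i, wf K (f i)
  | Disj _ f => forall i, wf K (f i)
  end.
Proof. intros []; auto. Qed.

Lemma small_FmFin : small K (FmFin G).
Proof. exact (small_inj (@singleton_inj (FmFin G)) HK). Qed.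

Lemma small_bool : small K bool.
Proof.
(* [G] may be empty, so two variable-free formulas serve as the distinct values. *)
apply small_inj with (2 := small_FmFin) (f := fun b : bool => if b then ffAnd [] else ffOr []).
intros [] []; congruence.
Qed.

Lemma small_False : small K False.
Proof.
apply small_inj with (2 := small_bool) (f := fun e : False => match e with end).
intros [].
Qed.

Lemma wf_boxn n (p : Fm G) : wf K p -> wf K (boxn n p).
Proof. induction n; simpl; auto using wf_box. Qed.

Lemma wf_embed (a : FmFin G) : wf K (embed a).
Proof.
revert a; fix IH 1; intros [g|a|a|[|a [|b l]]|l]; simpl;
  try (apply wf_conj; [exact small_False|intros []]).
- apply wf_var.
- apply wf_neg, IH.
- apply wf_box, IH.
- apply wf_conj; [exact small_bool|intros []; apply IH].
Qed.

Lemma wf_tr (s : nat -> Fm G) a : (forall n, wf K (s n)) -> wf K (tr s a).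
Proof.
intro Hs; induction a; simpl; auto using wf_neg, wf_box.
- apply wf_conj; [exact small_bool|intros []; auto].
- apply wf_disj; [exact small_bool|intros []; auto].
Qed.

Lemma prov_mono Gam Del Gam' Del' : prov Gam Del ->
  (forall p, Gam p -> Gam' p) -> (forall p, Del p -> Del' p) ->
  WS K Gam' -> WS K Del' -> prov Gam' Del'.
Proof.
intros H HG HD WG WD.
rewrite (@set_ext _ Gam' (un Gam Gam')) by firstorder.
rewrite (@set_ext _ Del' (un Del Del')) by firstorder.
apply r_w; [firstorder|firstorder|exact H].
Qed.

Lemma prov_eq Gam Del Gam' Del' : prov Gam Del ->
  (forall p, Gam p <-> Gam' p) -> (forall p, Del p <-> Del' p) -> prov Gam' Del'.
Proof. intros H HG HD; rewrite <- (set_ext _ _ HG), <- (set_ext _ _ HD); exact H. Qed.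

Lemma prov_ax Gam Del p : WS K Gam -> WS K Del -> Gam p -> Del p -> prov Gam Del.
Proof.
intros WG WD HG HD; apply prov_mono with (sing p) (sing p); auto.
- apply r_ax; auto.
- intros q ->; exact HG.
- intros q ->; exact HD.
Qed.

(** * Points of the canonical model and their existence *)

Definition co (X : Fm G -> Prop) : Fm G -> Prop := fun p => wf K p /\ ~ X p.

Definition pt (X : Fm G -> Prop) : Prop := WS K X /\ ~ prov X (co X).

Definition lem (p : Fm G) : Fm G := Disj bool (fun b : bool => if b then p else Neg p).

Lemma wf_lem p : wf K p -> wf K (lem p).
Proof. intro; apply wf_disj; [exact small_bool|intros []; auto using wf_neg]. Qed.

Lemma WS_none : WS K none.
Proof. intros p []. Qed.

Lemma WS_sing (p : Fm G) : wf K p -> WS K (sing p).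
Proof. intros H q ->; exact H. Qed.

Lemma WS_un (X Y : Fm G -> Prop) : WS K X -> WS K Y -> WS K (un X Y).
Proof. firstorder. Qed.

Lemma WS_conjuncts (A : Fm G -> Prop) : WS K A -> WS K (conjuncts A).
Proof. intros WA q (I & f & i & HA & ->); exact (wf_sub (WA _ HA) i). Qed.

Lemma WS_disjuncts (A : Fm G -> Prop) : WS K A -> WS K (disjuncts A).
Proof. intros WA q (I & f & i & HA & ->); exact (wf_sub (WA _ HA) i). Qed.

Lemma WS_co (X : Fm G -> Prop) : WS K (co X).
Proof. intros p []; auto. Qed.

Lemma prov_lem p : wf K p -> prov none (sing (lem p)).
Proof.
intro Hp.
pose proof (WS_disjuncts (WS_sing (wf_lem Hp))) as WD.
apply prov_eq with none (un none (sing (lem p))); [|tauto|unfold un, none; tauto].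
apply r_orR; [intros q ->; unfold lem; eauto|exact WS_none| |].
{ apply WS_un; [apply WS_none|apply WS_sing, wf_lem, Hp]. }
apply prov_mono with none (un (sing p) (negs (sing p))); try exact WS_none; auto.
- apply r_negR; [exact WS_none| |].
  + apply WS_un; [apply WS_sing, Hp|].
    intros q (r & -> & ->); apply wf_neg, Hp.
  + apply prov_ax with p; [|apply WS_sing, Hp|left; reflexivity|reflexivity].
    apply WS_un; [apply WS_sing, Hp|apply WS_none].
- intros q [->|(r & -> & ->)]; right; eexists _, _.
  + exists true; split; reflexivity.
  + exists false; split; reflexivity.
- apply WS_un; [apply WS_none|exact WD].
Qed.

(** If every choice between [p] and [Neg p] made the sequent derivable, (L\/) and a cut against the
    derivable formulas [lem p] would derive [Gam] => [Del]. A choice [c] that fails decides all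
    formulas at once. *)
Lemma lindenbaum Gam Del : WS K Gam -> WS K Del -> ~ prov Gam Del ->
  exists X, pt X /\ (forall p, Gam p -> X p) /\ (forall p, Del p -> ~ X p).
Proof.
intros WG WD N.
set (A := fun q => exists p, wf K p /\ q = lem p).
assert (WA : WS K A) by (intros q (p & Hp & ->); apply wf_lem, Hp).
assert (Hc : exists c, choice_disj A c /\ ~ prov (un (image c A) Gam) Del).
{ apply NNPP; intro Hc; apply N.
  apply prov_eq with (un none Gam) (un none Del); [|unfold un, none; tauto..].
  apply r_cut with A.
  - apply WS_un; [apply WS_none|exact WG].
  - apply WS_un; [apply WS_none|exact WD].
  - intros q (p & Hp & ->).
    apply prov_eq with none (sing (lem p)); [apply prov_lem, Hp|unfold un, none; tauto..].
  - apply r_orL; [intros q (p & _ & ->); unfold lem; eauto|apply WS_un; auto|exact WD|].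
    intros c Hch; apply NNPP; intro Nc; apply Hc; exists c; auto. }
destruct Hc as (c & Hc & Nc).
set (X := fun p => wf K p /\ c (lem p) = p).
assert (WX : WS K X) by (intros p []; auto).
(* The formulas picked by [c] include [X] and the negations of [co X]; (L~) produces those negations
   from [co X] on the right. *)
assert (Hno : ~ prov (un X Gam) (un Del (co X))).
{ intro H; apply Nc.
  assert (Hcv : forall p, wf K p -> c (lem p) = p \/ c (lem p) = Neg p).
  { intros p Hp; destruct (Hc bool (fun b : bool => if b then p else Neg p)) as [[] E];
      [exists p; auto|left; exact E|right; exact E]. }
  apply prov_mono with (un (negs (co X)) (un X Gam)) Del; auto.
  - apply r_negL; auto.
    apply WS_un; [|apply WS_un; auto].
    intros q (p & [Hp _] & ->); apply wf_neg, Hp.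
  - intros q [(p & [Hp Np] & ->)|[[Hq E]|Hq]]; [left|left|right; exact Hq].
    + exists (lem p); split; [exists p; auto|].
      destruct (Hcv p Hp) as [E|E]; [destruct Np; split; auto|auto].
    + exists (lem q); split; [exists q; auto|auto].
  - apply WS_un; auto.
    intros q (r & (p & Hp & ->) & ->).
    destruct (Hcv p Hp) as [-> | ->]; auto using wf_neg. }
assert (WGX : WS K (un X Gam)) by (apply WS_un; auto).
assert (WDX : WS K (un Del (co X))) by (apply WS_un; [auto|apply WS_co]).
assert (HG : forall p, Gam p -> X p).
{ intros p Hp; apply NNPP; intro Np; apply Hno.
  apply prov_ax with p; auto; [right; auto|right; split; auto]. }
assert (HD : forall p, Del p -> ~ X p).
{ intros p Hp Xp; apply Hno.
  apply prov_ax with p; auto; left; auto. }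
exists X; split; [split; [exact WX|]|auto].
intro H; apply Hno, prov_mono with (1 := H); auto; [left|right]; auto.
Qed.

(** * Membership in a point, connective by connective *)

(** Otherwise [Del] would lie inside [co X], and weakening would derive [co X] from [X]. The clauses
    below each feed one short derivation to this lemma. *)
Lemma pt_prov X Gam Del : pt X -> prov Gam Del -> WS K Del ->
  (forall p, Gam p -> X p) -> exists q, Del q /\ X q.
Proof.
intros [WX NX] H WD HG; apply NNPP; intro N; apply NX.
apply prov_mono with (1 := H); auto using WS_co.
intros p Hp; split; [auto|]; intro Xp; apply N; eauto.
Qed.

Lemma pt_sing X p : pt X -> prov none (sing p) -> wf K p -> X p.
Proof.
intros HX H Hp; destruct (pt_prov HX H (WS_sing Hp)) as (q & -> & Hq); [intros q []|exact Hq].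
Qed.

Lemma pt_neg X p : pt X -> wf K p -> (X (Neg p) <-> ~ X p).
Proof.
intros HX Hp; split.
- intros Hn Xp.
  destruct (@pt_prov X (un (negs (sing p)) (sing p)) none) as (q & [] & _);
    auto using WS_none.
  + apply r_negL; [|apply WS_none|].
    * apply WS_un; [|apply WS_sing, Hp]; intros q (r & -> & ->); auto using wf_neg.
    * apply prov_ax with p; [apply WS_sing, Hp| |reflexivity|right; reflexivity].
      apply WS_un; [apply WS_none|apply WS_sing, Hp].
  + intros q [(r & -> & ->)| ->]; auto.
- intro Np.
  assert (W : WS K (un (sing p) (negs (sing p)))).
  { apply WS_un; [apply WS_sing, Hp|]; intros q (r & -> & ->); auto using wf_neg. }
  destruct (@pt_prov X none (un (sing p) (negs (sing p)))) as (q & Hq & Xq);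
    auto; [|intros q []|].
  + apply r_negR; [apply WS_none|exact W|].
    apply prov_ax with p; [|apply WS_sing, Hp|left; reflexivity|reflexivity].
    apply WS_un; [apply WS_sing, Hp|apply WS_none].
  + destruct Hq as [-> | (r & -> & ->)]; [contradiction|exact Xq].
Qed.

Lemma pt_conj X I f : pt X -> wf K (Conj I f) -> (X (Conj I f) <-> forall i, X (f i)).
Proof.
intros HX Hp; pose proof (wf_sub Hp) as Hf; simpl in Hf; split.
- intros XC i.
  destruct (@pt_prov X (un (sing (Conj I f)) none) (sing (f i))) as (q & -> & Xq);
    auto using WS_sing; [|intros q [-> | []]; exact XC].
  apply r_andL; [intros q ->; eauto| |apply WS_sing, Hf|].
  + apply WS_un; [apply WS_sing, Hp|apply WS_none].
  + apply prov_ax with (f i); [|apply WS_sing, Hf|left; exists I, f, i|reflexivity].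
    * apply WS_un; [apply WS_conjuncts, WS_sing, Hp|apply WS_none].
    * split; reflexivity.
- intro Xf.
  destruct (@pt_prov X (fun q => exists i, q = f i) (un none (sing (Conj I f))))
    as (q & [[] | ->] & Xq); auto.
  + apply r_andR; [intros q ->; eauto|intros q [i ->]; auto| |].
    * apply WS_un; [apply WS_none|apply WS_sing, Hp].
    (* Whichever conjunct the choice picks already stands on the left. *)
    * intros c Hc; destruct (Hc I f) as [i E]; [reflexivity|].
      apply prov_ax with (f i); [intros q [j ->]; auto| |exists i; auto|].
      -- apply WS_un; [apply WS_none|]; intros q (r & -> & ->); rewrite E; auto.
      -- right; exists (Conj I f); split; [reflexivity|auto].
  + apply WS_un; [apply WS_none|apply WS_sing, Hp].
  + intros q [i ->]; auto.
Qed.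

Lemma pt_disj X I f : pt X -> wf K (Disj I f) -> (X (Disj I f) <-> exists i, X (f i)).
Proof.
intros HX Hp; pose proof (wf_sub Hp) as Hf; simpl in Hf; split.
- intro XD.
  destruct (@pt_prov X (un (sing (Disj I f)) none) (fun q => exists i, q = f i))
    as (q & [i ->] & Xq); eauto.
  + apply r_orL; [intros q ->; eauto| |intros q [i ->]; auto|].
    * apply WS_un; [apply WS_sing, Hp|apply WS_none].
    * intros c Hc; destruct (Hc I f) as [i E]; [reflexivity|].
      apply prov_ax with (f i); [|intros q [j ->]; auto| |exists i; auto].
      -- apply WS_un; [|apply WS_none]; intros q (r & -> & ->); rewrite E; auto.
      -- left; exists (Disj I f); split; [reflexivity|auto].
  + intros q [i ->]; auto.
  + intros q [-> | []]; exact XD.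
- intros [i Xf].
  destruct (@pt_prov X (sing (f i)) (un none (sing (Disj I f))))
    as (q & [[] | ->] & Xq); auto.
  + apply r_orR; [intros q ->; eauto|apply WS_sing, Hf| |].
    * apply WS_un; [apply WS_none|apply WS_sing, Hp].
    * apply prov_ax with (f i); [apply WS_sing, Hf| |reflexivity|].
      -- apply WS_un; [apply WS_none|apply WS_disjuncts, WS_sing, Hp].
      -- right; exists I, f, i; split; reflexivity.
  + apply WS_un; [apply WS_none|apply WS_sing, Hp].
  + intros q ->; auto.
Qed.

Definition acc (X Y : Fm G -> Prop) : Prop := forall p, X (Box p) -> Y p.

(** Either the formulas boxed in [X] derive [p], and (Nec) yields [Box p], or [lindenbaum] extends
    them to a successor that omits [p]. *)
Lemma pt_box X p : pt X -> wf K p -> (forall Y, pt Y -> acc X Y -> Y p) -> X (Box p).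
Proof.
intros HX Hp H.
assert (WB : WS K (boxes (fun q => X (Box q)))).
{ intros q (r & Hr & ->); apply (proj1 HX), Hr. }
assert (HS : prov (fun q => X (Box q)) (sing p)).
{ apply NNPP; intro N.
  destruct (lindenbaum (Gam := fun q => X (Box q)) (Del := sing p)) as (Y & HY & H1 & H2);
    auto using WS_sing.
  - intros q Hq; exact (wf_sub (proj1 HX _ Hq)).
  - apply (H2 p); [reflexivity|apply H; auto]. }
destruct (@pt_prov X (boxes (fun q => X (Box q))) (sing (Box p))) as (q & -> & Xq);
  auto using WS_sing, wf_box.
- apply r_nec; auto using WS_sing, wf_box.
- intros q (r & Hr & ->); exact Hr.
Qed.

Lemma pt_axiom X p : pt X -> T p \/ Linst K L p -> X p.
Proof.
intros HX H.
assert (Hp : wf K p) by (destruct H as [H|(a & s & _ & Hs & ->)]; auto using wf_tr).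
apply pt_sing; auto.
apply r_TL with (sing p); [apply WS_none|apply WS_sing, Hp|intros q ->; exact H|].
apply prov_ax with p; [|apply WS_sing, Hp|left; reflexivity|reflexivity].
apply WS_un; [apply WS_sing, Hp|apply WS_none].
Qed.

Lemma pt_boxn_valid n p : wf K p -> (forall Y, pt Y -> Y p) -> forall X, pt X -> X (boxn n p).
Proof.
intros Hp H; induction n as [|n IH]; intros X HX; [exact (H X HX)|].
apply (@pt_box X (boxn n p) HX (wf_boxn n Hp)).
intros Y HY _; exact (IH Y HY).
Qed.

(** Contrapositive of (lf): if each list [l] left some restricted formula outside [X], that formula
    would occur on both sides of the premise for [l], so (lf) would derive [co X] from [X]. *)
Lemma pt_lf X (Is : nat -> Type) (fs : forall n, Is n -> Fm G) :
  pt X -> (forall n, X (boxn n (Disj (Is n) (fs n)))) ->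
  (forall n l, wf K (boxn n (Disj {i : Is n | In (fs n i) l} (fun i => fs n (proj1_sig i))))) ->
  exists l, forall n, X (boxn n (Disj {i : Is n | In (fs n i) l} (fun i => fs n (proj1_sig i)))).
Proof.
intros [WX NX] H W; apply NNPP; intro N; apply NX.
(* [lf_set Is fs] is contained in [X], so adjoining it changes nothing. *)
apply prov_eq with (un (lf_set Is fs) X) (co X); [| |tauto].
- apply r_lf; [|apply WS_co|].
  + intros p [[n ->]|Hp]; auto.
  + intros l _.
    destruct (not_all_ex_not _ _ (fun H => N (ex_intro _ l H))) as [n Hn].
    eapply prov_ax; [|apply WS_co|left; exists n; reflexivity|split; auto].
    intros p [[m ->]|Hp]; auto.
- intro p; split; [intros [[n ->]|Hp]; auto|right; auto].
Qed.

(** * Finitary theories and their characteristic formulas *)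

Definition th (X : Fm G -> Prop) : FmFin G -> Prop := fun a => X (embed a).

Definition char (d : FmFin G -> Prop) : Fm G :=
  Conj (FmFin G) (fun a => if excluded_middle_informative (d a) then embed a else Neg (embed a)).

Lemma wf_char d : wf K (char d).
Proof.
apply wf_conj; [exact small_FmFin|intro a].
destruct excluded_middle_informative; auto using wf_neg, wf_embed.
Qed.

Lemma pt_char X d : pt X -> (X (char d) <-> th X = d).
Proof.
intro HX; unfold char at 1; rewrite (@pt_conj X _ _ HX (wf_char d)).
split; [intro H; apply set_ext; intro a; specialize (H a)|intros <- a; fold (th X a)];
  destruct excluded_middle_informative as [D|D]; unfold th in *.
- tauto.
- rewrite pt_neg in H by auto using wf_embed; tauto.
- exact D.
- rewrite pt_neg by auto using wf_embed; exact D.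
Qed.

(** The bound [HK] enters here: any set of finitary theories has fewer than kappa members. *)
Lemma wf_disj_char (P : (FmFin G -> Prop) -> Prop) :
  wf K (Disj {d | P d} (fun d => char (proj1_sig d))).
Proof. apply wf_disj; [apply small_sig, HK|intro; apply wf_char]. Qed.

Lemma pt_disj_char X P : pt X -> X (Disj {d | P d} (fun d => char (proj1_sig d))) -> P (th X).
Proof.
intros HX H; rewrite pt_disj in H by auto using wf_disj_char.
destruct H as [[d Hd] H]; apply (pt_char d HX) in H; subst d; exact Hd.
Qed.

(** By induction on [l]: an entry characterising a realised theory other than that of [U]
    contributes one conjunct, a finitary formula true at [U] and false there. *)
Lemma separation U (l : list (Fm G)) : pt U ->
  exists a, th U a /\ forall Y, pt Y -> In (char (th Y)) l -> th Y a -> th Y = th U.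
Proof.
intro HU; induction l as [|q l (a & Ha & IH)].
- exists (ffAnd []); split; [|intros Y _ []].
  unfold th; simpl; rewrite pt_conj; auto; [intros []|exact (wf_embed (ffAnd []))].
- destruct (classic (exists Y, pt Y /\ char (th Y) = q /\ th Y <> th U)) as [(Y & HY & <- & N)|N].
  + assert (Hb : exists b, th U b /\ ~ th Y b).
    { apply NNPP; intro Nb; apply N, set_ext; intro b.
      (* A formula held by [Y] alone is turned into one held by [U] alone by negating it. *)
      split; intro H; apply NNPP; intro H'; apply Nb; [exists (ffNeg b)|exists b; auto].
      unfold th in *; simpl; rewrite !pt_neg by auto using wf_embed; tauto. }
    destruct Hb as (b & Ub & Yb); exists (ffAnd [a; b]).
    assert (Hand : forall Z, pt Z -> (th Z (ffAnd [a; b]) <-> th Z a /\ th Z b)).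
    { intros Z HZ; unfold th at 1; simpl.
      rewrite pt_conj; auto; [|exact (wf_embed (ffAnd [a; b]))].
      split; [intro H; exact (conj (H true) (H false))|intros [? ?] []; assumption]. }
    split; [apply Hand; auto|].
    intros Z HZ [E|HIn] HZab; apply Hand in HZab; auto; destruct HZab as [Za Zb]; auto.
    assert (E' : th Z = th Y) by (apply pt_char; [|rewrite E; apply pt_char]; auto).
    destruct Yb; rewrite <- E'; exact Zb.
  + exists a; split; auto.
    intros Y HY [E|HIn] Ya; auto.
    apply NNPP; intro NE; apply N; exists Y; auto.
Qed.

(** * The finite quotient of the reachable points *)

Section Quotient.
Variable X : Fm G -> Prop.
Hypothesis HX : pt X.

(** Phrased through [boxn] rather than chains of [acc], to match the formulas in (lf). *)
Definition reach (Y : Fm G -> Prop) : Prop := pt Y /\ exists n, forall p, X (boxn n p) -> Y p.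

Lemma reach_root : reach X.
Proof. split; [exact HX|exists 0; auto]. Qed.

Lemma reach_acc Y Z : reach Y -> pt Z -> acc Y Z -> reach Z.
Proof.
intros [_ [n Hn]] HZ HA; split; [exact HZ|exists (S n); intros p Hp].
apply HA, Hn.
(* [boxn] adds boxes outside, whereas the step from [Y] to [Z] consumes the innermost box. *)
replace (boxn n (Box p)) with (boxn (S n) p); [exact Hp|].
clear; induction n as [|n IH]; [reflexivity|simpl in *; congruence].
Qed.

(** Using the same family [char] at every level of (lf) gives a single list valid at all distances
    [n]. *)
Lemma reach_finite : exists l, forall Y, reach Y -> In (char (th Y)) l.
Proof.
assert (W : forall P, wf K (Disj {d : FmFin G -> Prop | P d} (fun d => char (proj1_sig d))))
  by exact wf_disj_char.
destruct (@pt_lf X (fun _ => FmFin G -> Prop) (fun _ => char)) as [l Hl]; auto.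
- intro n; apply pt_boxn_valid; auto.
  + apply wf_disj; [exact HK|exact wf_char].
  + intros Y HY; apply pt_disj; auto.
    * apply wf_disj; [exact HK|exact wf_char].
    * exists (th Y); apply pt_char; auto.
- intros n l; apply wf_boxn, W.
- exists l; intros Y [HY [n Hn]].
  exact (@pt_disj_char Y (fun d => In (char d) l) HY (Hn _ (Hl n))).
Qed.

(** Let [a] isolate the theory of [Y'] among the reachable ones. If no successor of [Z] had that
    theory, [Z] would contain the box of the negation of [a]; so would [Y], contradicting [a] at
    [Y']. *)
Lemma bisimulation Y Y' Z : reach Y -> reach Z -> pt Y' -> th Y = th Z -> acc Y Y' ->
  exists Z', pt Z' /\ acc Z Z' /\ th Z' = th Y'.
Proof.
intros HY HZ HY' E HA; destruct reach_finite as [l Hl].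
destruct (separation l HY') as (a & Ha & Hsep).
apply NNPP; intro N.
assert (HB : th Y (ffBox (ffNeg a))).
{ rewrite E; apply (pt_box (p := embed (ffNeg a))); [apply HZ|apply (wf_embed (ffNeg a))|].
  intros Z' HZ' HA'; apply (pt_neg HZ' (wf_embed a)); intro Za.
  apply N; exists Z'; split; [|split]; auto.
  apply Hsep; auto; apply Hl, (reach_acc HZ); auto. }
apply (HA (embed (ffNeg a))), (pt_neg HY' (wf_embed a)) in HB; exact (HB Ha).
Qed.

Definition world : Type := {d : FmFin G -> Prop | exists Y, reach Y /\ th Y = d}.

(** Some pair of representatives suffices; [bisimulation] transfers the step to any other
    representative of [w]. *)
Definition wacc (w w' : world) : Prop :=
  exists Y Y', reach Y /\ reach Y' /\ acc Y Y' /\ th Y = proj1_sig w /\ th Y' = proj1_sig w'.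

Definition wval (g : G) (w : world) : Prop := proj1_sig w (ffVar g).

Definition wof Y (HY : reach Y) : world := exist _ (th Y) (ex_intro _ Y (conj HY eq_refl)).

Lemma truth p : wf K p -> forall Y w, reach Y -> th Y = proj1_sig w ->
  (eval wacc wval p w <-> Y p).
Proof.
induction p as [g|p IH|p IH|I f IH|I f IH]; intros Hp Y w HY E; pose proof (wf_sub Hp) as Hs;
  simpl in Hs; simpl eval.
- unfold wval; rewrite <- E; reflexivity.
- rewrite pt_neg by (auto; apply HY); rewrite (IH Hs Y w) by auto; reflexivity.
- split; intro H.
  + apply pt_box; [apply HY|exact Hs|]; intros Z HZ HA.
    pose proof (reach_acc HY HZ HA) as RZ.
    apply (IH Hs Z (wof RZ)); auto.
    apply H; exists Y, Z; auto.
  (* The step from [w] is witnessed at [U], so it is first moved to the given representative [Y]. *)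
  + intros w' (U & U' & HU & HU' & HA & E1 & E2).
    destruct (@bisimulation U U' Y) as (Z' & HZ' & HA' & E'); auto; [apply HU'|congruence|].
    apply (IH Hs Z' w'); [exact (reach_acc HY HZ' HA')|congruence|apply HA', H].
- rewrite pt_conj by (auto; apply HY).
  split; intros H i; apply (IH i (Hs i) Y w); auto.
- rewrite pt_disj by (auto; apply HY).
  split; intros [i H]; exists i; apply (IH i (Hs i) Y w); auto.
Qed.

Lemma truth_valid p : wf K p -> (forall Y, pt Y -> Y p) -> forall w, eval wacc wval p w.
Proof.
intros Hp H [d [Y [HY E]]]; apply (@truth p Hp Y); auto; apply H, HY.
Qed.

Lemma world_loc_finite : loc_finite wacc.
Proof.
destruct reach_finite as [l Hl].
destruct (@finite_preimage world (Fm G) (fun w => char (proj1_sig w)) l) as [lw Hlw].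
- intros [d [Y [[HY nY] E]]] [d' H'] Ec; simpl in Ec.
  assert (d = d') as <-.
  (* [char] is injective on realised theories: [Y] satisfies [char d], which equals [char d'], so
     its theory is also [d']. *)
  { rewrite <- E; apply pt_char; [exact HY|rewrite <- Ec; apply pt_char; auto]. }
  f_equal; apply proof_irrelevance.
- intro w; exists lw; intros [d [Y [HY E]]] _; apply Hlw; simpl; subst d; auto.
Qed.

(** Substitution lemma: for a valuation definable by formulas [s n], truth of [a] is truth of its
    instance. *)
Lemma eval_tr s V a :
  (forall n w, eval wacc wval (s n) w <-> V n w) ->
  forall w, eval wacc wval (tr s a) w <-> bsem wacc V a w.
Proof.
intro H; induction a as [n|a IH|a IHa b IHb|a IHa b IHb|a IH]; intro w; simpl.
- apply H.
- rewrite IH; reflexivity.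
- rewrite <- IHa, <- IHb; split;
    [intro Hi; exact (conj (Hi true) (Hi false))|intros [? ?] []; assumption].
- rewrite <- IHa, <- IHb; split; [intros [[] Hi]; auto|].
  intros [Hi|Hi]; [exists true|exists false]; exact Hi.
- split; intros Hi w' Hw; apply IH; auto.
Qed.

Lemma world_valid : frame_valid wacc L.
Proof.
intros V a La.
(* Each [V n] is defined by the disjunction of the characteristic formulas of its worlds. *)
set (s := fun n => Disj {d | exists w : world, proj1_sig w = d /\ V n w}
                        (fun d => char (proj1_sig d))).
assert (Hs : forall n, wf K (s n)) by (intro; apply wf_disj_char).
intro w; apply eval_tr with s.
- clear w; intros n [d [Y [HY E]]].
  rewrite (truth (Hs n) (Y := Y)) by auto.
  split; intro H.
  + apply pt_disj_char in H; [|apply HY]; destruct H as (w' & E' & Hw').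
    replace (exist _ d _) with w'; auto.
    destruct w' as [d' H']; simpl in E'.
    assert (d' = d) as -> by exact (eq_trans E' E).
    f_equal; apply proof_irrelevance.
  + apply pt_disj; [apply HY|apply Hs|].
    unshelve eexists; [exists d; eexists; split; [|exact H]; reflexivity|].
    apply pt_char; [apply HY|exact E].
- apply truth_valid; [apply wf_tr, Hs|].
  intros Y HY; apply pt_axiom; auto.
  right; exists a, s; auto.
Qed.
End Quotient.

(** * Completeness: refutation at the root world *)

Lemma completeness Gam Del : WS K Gam -> WS K Del -> valid L T Gam Del -> prov Gam Del.
Proof.
intros WG WD HV; apply NNPP; intro N.
destruct (lindenbaum WG WD N) as (X & HX & HG & HD).
pose proof (reach_root HX) as RX.
pose proof (fun p Hp => @truth X HX p Hp X (wof RX) RX eq_refl) as HT.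
destruct (HV (world X) (@wacc X) (world_loc_finite HX) (world_valid HX) (@wval X))
  with (x := wof RX) as (q & Dq & Eq).
- intros p Tp; apply truth_valid; auto.
  intros Y HY; apply pt_axiom; auto.
- intros p Gp; apply HT; auto.
- apply (HD q Dq), HT; auto.
Qed.
End Canonical.

Theorem theorem4p8 (G K : Type) (L : BFm -> Prop) (T Gam Del : Fm G -> Prop) :
  normal_logic L -> fmp L -> sufficiently_large G K ->
  WS K T -> WS K Gam -> WS K Del ->
  valid L T Gam Del -> Prov K L T Gam Del.
Proof.
intros _ _ HK WT; apply completeness; auto using sufficiently_large_small.
Qed.
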